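(* Let $Z\subseteq X$ be an irreducible component with reduced subscheme $Z_{\mathrm{red}}$, and let $\rho(Z)$ be its generic Gram rank. Let $\mu\in Z_{\mathrm{red}}(\Bbbk)$ and assume that $\overline{G\cdot\mu}=Z_{\mathrm{red}}$ (in particular, this holds if $G\cdot\mu$ is Zariski open in $Z_{\mathrm{red}}$). Then $\mathrm{rank}(\gamma_\mu)=\rho(Z)$.
   Context: $\Bbbk$ is an algebraically closed field of characteristic $0$, $W$ is a finite-dimensional $\Bbbk$-vector space, and $G=\mathrm{GL}(W)$ acts on $\mathrm{Hom}_\Bbbk(W\otimes W,W)$ by $(g\cdot\mu)(x,y)=g\,\mu(g^{-1}x,g^{-1}y)$. $A_W$ denotes one of the $G$-representations $\mathrm{Hom}(W^{\otimes 2},W)$, $\mathrm{Hom}(\mathrm{Sym}^2W,W)$, $\mathrm{Hom}(\Lambda^2W,W)$, also viewed as an affine space. $Q\subseteq \mathrm{Sym}^2(A_W^\vee)$ is a fixed $G$-stable subspace of quadratic forms and $X=\mathrm{Var}(Q)\subseteq A_W$ is the closed subscheme they cut out. For $\mu\in A_W$ and $v\in W$ let $R^\mu_v\in\mathrm{End}(W)$, $R^\mu_v(w)=\mu(w,v)$. The Gram form of $\mu$ is the symmetric bilinear form $\gamma_\mu(v,w)=\mathrm{Tr}(R^\mu_vR^\mu_w)$ on $W$. For an irreducible component $Z$ of $X$, the generic Gram rank $\rho(Z)$ is the unique integer such that $\{\mu\in Z_{\mathrm{red}}\mid\mathrm{rank}(\gamma_\mu)=\rho(Z)\}$ is dense and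 open in $Z_{\mathrm{red}}$; it equals the maximum of $\mathrm{rank}(\gamma_\mu)$ on $Z_{\mathrm{red}}$. *)

(* Defs.v *)
From HB Require Import structures.
From mathcomp Require Import all_boot all_algebra.
From mathcomp Require Import mpoly.
From mathcomp Require Import boolp classical_sets topology_structure.

Set Implicit Arguments.
Unset Strict Implicit.
Unset Printing Implicit Defensive.

Import GRing.Theory.
Local Open Scope classical_set_scope.
Local Open Scope ring_scope.

Section PolynomialFunctions.
Context (K : fieldType) (V : vectType K).
Implicit Types (p : {mpoly K[\dim {:V}]}) (v : V) (phi : 'End(V)).

(* A polynomial function on V is a polynomial in the linear coordinates       *)
(* attached to the basis [vbasis fullv] of V, so that Sym^d(V^dual) is the    *)
(* space of d-homogeneous polynomials in [\dim {:V}] variables.               *)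
Definition peval p v : K := p.@[fun i => coord (vbasis fullv) i v].

(* p \o phi, as a polynomial. *)
Definition pullback phi p : {mpoly K[\dim {:V}]} :=
  p \mPo [tuple \sum_(j < \dim {:V})
            coord (vbasis fullv) i (phi (vbasis fullv)`_j) *: 'X_j
         | i < \dim {:V}].

Lemma peval_pullback phi p v : peval (pullback phi p) v = peval p (phi v).
Proof.
rewrite /peval /pullback comp_mpoly_meval; apply: meval_eq => i.
rewrite !tnth_map tnth_ord_tuple raddf_sum /=.
rewrite {2}(coord_vbasis (memvf v)) !linear_sum /=; apply: eq_bigr => j _.
by rewrite mevalZ mevalXU !linearZ /= mulrC.
Qed.

Definition zeros (S : set {mpoly K[\dim {:V}]}) : set V :=
  [set v | forall p, S p -> peval p v = 0].

Lemma zerosU S1 S2 : zeros S1 `|` zeros S2 =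
  zeros [set p | exists p1 p2, [/\ S1 p1, S2 p2 & p = p1 * p2]].
Proof.
apply/seteqP; split=> [v [] Sv _ [p1 [p2 [Sp1 Sp2 ->]]]|v Sv].
- by rewrite /peval mevalM [X in X * _]Sv ?mul0r.
- by rewrite /peval mevalM [X in _ * X]Sv ?mulr0.
have [|/existsNP[p1 /not_implyP[Sp1 /eqP p1v]]] :=
  pselect (zeros S1 v); first by left.
right=> p2 Sp2; apply/eqP; have /eqP := Sv _ (ex_intro _ p1
  (ex_intro _ p2 (And3 Sp1 Sp2 erefl))).
by rewrite /peval mevalM mulf_eq0 (negbTE p1v).
Qed.

Definition zariski_open (U : set V) : Prop := exists S, ~` U = zeros S.

Lemma zariski_openT : zariski_open setT.
Proof.
exists setT; rewrite setCT; apply/seteqP; split=> // v /(_ 1 I) /eqP.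
by rewrite /peval meval1 oner_eq0.
Qed.

Lemma zariski_openI : setI_closed zariski_open.
Proof.
move=> U1 U2 [S1 U1E] [S2 U2E].
by rewrite /zariski_open setCI U1E U2E zerosU; eexists.
Qed.

Lemma zariski_open_bigU (J : Type) (f : J -> set V) :
  (forall i, zariski_open (f i)) -> zariski_open (\bigcup_i f i).
Proof.
move=> /choice[S fE]; exists (\bigcup_i S i); rewrite setC_bigcup.
apply/seteqP; split=> v.
  by move=> Sv p [i _ Sip]; have := Sv i I; rewrite fE; apply.
by move=> Sv i _; rewrite fE => p Sip; apply: Sv; exists i.
Qed.

End PolynomialFunctions.

(* Alias of V carrying the Zariski topology on its K-points. *)
Definition affine (K : fieldType) (V : vectType K) : Type := V.

HB.instance Definition _ (K : fieldType) (V : vectType K) :=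
  Choice.on (affine V).
HB.instance Definition _ (K : fieldType) (V : vectType K) :=
  isOpenTopological.Build (affine V) (@zariski_openT K V)
    (@zariski_openI K V) (@zariski_open_bigU K V).

Lemma zariski_openE (K : fieldType) (V : vectType K) :
  @open (affine V) = @zariski_open K V.
Proof. by []. Qed.

Lemma zariski_closedP (K : fieldType) (V : vectType K) (F : set (affine V)) :
  closed F <-> exists S, F = zeros S.
Proof. by rewrite -openC zariski_openE /zariski_open setCK. Qed.

Section RelativeTopology.
Context (T : topologicalType).
Implicit Types Z S X : set T.

Definition open_in Z S : Prop := exists2 U, open U & S = Z `&` U.

Definition dense_in Z S : Prop := S `<=` Z /\ Z `<=` closure S.

Definition irreducible_set Z : Prop :=
  Z !=set0 /\ forall F1 F2, closed F1 -> closed F2 ->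
    Z `<=` F1 `|` F2 -> Z `<=` F1 \/ Z `<=` F2.

(* Such a Z is automatically closed in X. For X the set of K-points of a      *)
(* scheme of finite type over an algebraically closed K, these are the sets   *)
(* of K-points of the irreducible components, with their reduced structure.   *)
Definition irreducible_component X Z : Prop :=
  [/\ Z `<=` X, irreducible_set Z &
      forall Y, irreducible_set Y -> Y `<=` X -> Z `<=` Y -> Y = Z].

End RelativeTopology.

Section BilinearProducts.
Context (K : fieldType) (W : vectType K).

(* Hom(W (x) W, W), a tensor mu being identified with the curried bilinear    *)
(* map x |-> (y |-> mu x y).                                                  *)
Notation product := 'Hom(W, 'End(W)).
Implicit Types (mu : product) (g : 'End(W)) (v w : W).

Definition GL : {pred 'End(W)} := [pred g | lker g == 0%VS].

Definition mulr_lfun mu v : 'End(W) := linfun (fun w => mu w v).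

Lemma mulr_lfunE mu v w : mulr_lfun mu v w = mu w v.
Proof.
rewrite /mulr_lfun; pose f w := mu w v.
have fL : linear f by move=> a x y; rewrite /f linearP add_lfunE scale_lfunE.
pose fM := GRing.isLinear.Build _ _ _ _ f fL.
pose F : {linear _ -> _} := HB.pack f fM.
exact: (lfunE F).
Qed.

Definition flip mu : product := linfun (mulr_lfun mu).

Lemma flipE mu v w : flip mu v w = mu w v.
Proof.
rewrite /flip; pose f := mulr_lfun mu.
have fL : linear f.
  move=> a x y; apply/lfunP => z.
  by rewrite add_lfunE scale_lfunE !mulr_lfunE linearP.
pose fM := GRing.isLinear.Build _ _ _ _ f fL.
pose F : {linear _ -> _} := HB.pack f fM.
by rewrite (lfunE F) /= mulr_lfunE.
Qed.

Lemma flip_linear : linear flip.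
Proof.
move=> a m n; apply/lfunP => x; apply/lfunP => y.
by rewrite !(add_lfunE, scale_lfunE, flipE).
Qed.
HB.instance Definition _ :=
  GRing.isLinear.Build K product product _ flip flip_linear.

(* Hom(W (x) W, W), Hom(Sym^2 W, W) and Hom(Lambda^2 W, W); the last one is   *)
(* cut out by mu x y = - mu y x, which amounts to mu x x = 0 in               *)
(* characteristic 0 (see anticommutativeP).                                   *)
Inductive product_kind := Arbitrary | Commutative | Anticommutative.

Definition products (k : product_kind) : {vspace product} :=
  match k with
  | Arbitrary => fullv
  | Commutative => lker (linfun flip - \1%VF)
  | Anticommutative => lker (linfun flip + \1%VF)
  end.

Lemma commutativeP mu :
  reflect (forall x y, mu x y = mu y x) (mu \in products Commutative).
Proof.
rewrite memv_ker add_lfunE opp_lfunE id_lfunE lfunE subr_eq0 /=.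
apply: (iffP eqP) => [mE x y|muC]; first by rewrite -{1}mE flipE.
by apply/lfunP => x; apply/lfunP => y; rewrite flipE.
Qed.

Lemma anticommutativeP (K0 : [pchar K] =i pred0) mu :
  reflect (forall x, mu x x = 0) (mu \in products Anticommutative).
Proof.
rewrite memv_ker add_lfunE id_lfunE lfunE /=.
apply: (iffP eqP) => [mE x|muA].
  have := congr1 (fun h : product => h x x) mE.
  rewrite /= !add_lfunE flipE !zero_lfunE -mulr2n -scaler_nat => /eqP.
  by rewrite scaler_eq0 (pcharf0P _).1 //= => /eqP.
apply/lfunP => x; apply/lfunP => y; rewrite !add_lfunE flipE !zero_lfunE.
have := muA (x + y).
by rewrite !linearD /= !add_lfunE !muA add0r addr0 addrC.
Qed.

Definition transport g mu : product :=
  linfun (fun x => g \o mu (g^-1%VF x) \o g^-1)%VF.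

Lemma transportE g mu x y :
  transport g mu x y = g (mu (g^-1%VF x) (g^-1%VF y)).
Proof.
rewrite /transport; pose f x := (g \o mu (g^-1%VF x) \o g^-1)%VF.
have fL : linear f.
  move=> a u v; apply/lfunP => z.
  by rewrite add_lfunE scale_lfunE !comp_lfunE !linearP add_lfunE scale_lfunE linearP.
pose fM := GRing.isLinear.Build _ _ _ _ f fL.
pose F : {linear _ -> _} := HB.pack f fM.
by rewrite (lfunE F) /= !comp_lfunE.
Qed.

Lemma transport_linear g : linear (transport g).
Proof.
move=> a m n; apply/lfunP => x; apply/lfunP => y.
by rewrite !(add_lfunE, scale_lfunE, transportE) linearP.
Qed.
HB.instance Definition _ g :=
  GRing.isLinear.Build K product product _ (transport g) (transport_linear g).

Lemma transport_products k g mu :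
  mu \in products k -> transport g mu \in products k.
Proof.
case: k => [|/commutativeP muC|]; first by rewrite !memvf.
  by apply/commutativeP => x y; rewrite !transportE muC.
rewrite !memv_ker !add_lfunE !id_lfunE !lfunE /= => /eqP muA; apply/eqP.
apply/lfunP => x; apply/lfunP => y.
rewrite !add_lfunE flipE !transportE !zero_lfunE -linearD.
have := congr1 (fun h : product => h (g^-1%VF x) (g^-1%VF y)) muA.
by rewrite /= !add_lfunE flipE !zero_lfunE => ->; rewrite linear0.
Qed.

Definition lfun_trace (f : 'End(W)) : K :=
  \tr (passmx.mxof (vbasis {:W}) (vbasis {:W}) f).

Definition gram_form mu v w : K :=
  lfun_trace (mulr_lfun mu v \o mulr_lfun mu w)%VF.

Definition form_rank (b : W -> W -> K) : nat :=
  \rank (\matrix_(i < \dim {:W}, j < \dim {:W})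
           b (vbasis {:W})`_i (vbasis {:W})`_j).

Definition gram_rank mu : nat := form_rank (gram_form mu).

End BilinearProducts.
Arguments GL {K} W.

Notation product_space W k := (subvs_of (products W k)).

Section ProductVarieties.
Context (K : fieldType) (W : vectType K) (k : product_kind).
Notation A := (product_space W k).
Implicit Types (mu : A) (g : 'End(W)).

Definition act g : 'End(A) :=
  linfun (vsproj (products W k) \o transport g \o vsval).

Lemma actE g mu : vsval (act g mu) = transport g (vsval mu).
Proof. by rewrite lfunE /= vsprojK // transport_products // subvsP. Qed.

Definition GL_orbit mu : set (affine A) := [set act g mu | g in [set g | g \in GL W]].

(* Q is G-stable for the contragredient action (g . q)(mu) = q (g^-1 . mu).   *)
Definition GL_stable (Q : {pred {mpoly K[\dim {:A}]}}) : Prop :=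
  forall g q, g \in GL W -> q \in Q -> pullback (act g^-1%VF) q \in Q.

Definition Var (Q : {pred {mpoly K[\dim {:A}]}}) : set (affine A) :=
  zeros [set q | q \in Q].

Definition is_generic_gram_rank (Z : set (affine A)) (r : nat) : Prop :=
  let Zr := [set mu | Z mu /\ gram_rank (vsval mu) = r] in
  open_in Z Zr /\ dense_in Z Zr.

(* The value 0 is used only if no such r exists. *)
Definition generic_gram_rank (Z : set (affine A)) : nat :=
  xget 0%N (is_generic_gram_rank Z).

End ProductVarieties.

(* Main.v *)
Require Import Defs.
From HB Require Import structures.
From mathcomp Require Import all_boot all_algebra.
From mathcomp Require Import mpoly.
From mathcomp Require Import boolp classical_sets topology_structure.

(** The Gram form is natural in the algebra: $\gamma_{g\mu}(v, w) =
    \gamma_\mu(g^{-1}v, g^{-1}w)$, because right multiplications are conjugated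
    by [g] and the trace is invariant under conjugation.  Hence the Gram rank
    is constant on an orbit ([gram_rank_act]).  Moreover the Gram matrix of
    $\mu$ has entries polynomial in $\mu$, so the locus where its rank is at
    least [r] is Zariski open ([gram_rank_ge_open]).

    Let the orbit of $\mu$ be dense in [Z] and put $r = $ [gram_rank mu].  The
    closed locus of Gram rank at most [r] contains the orbit, hence [Z]; so
    inside [Z] Gram rank [r] is the same as Gram rank at least [r], an open
    condition, and it holds on a dense set since it holds on the orbit.  So
    [r] is a generic Gram rank.  No other value can be one, since a relatively
    open neighbourhood of $\mu$ in [Z] meets every dense subset of [Z].

    That a relatively open orbit in the irreducible set [Z] is dense is pure
    topology: [Z] is covered by the closure of the orbit and by the complement
    of an open set cutting the orbit out of [Z]. *)

Set Implicit Arguments.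
Unset Strict Implicit.
Unset Printing Implicit Defensive.

Import GRing.Theory passmx.
Local Open Scope classical_set_scope.
Local Open Scope ring_scope.

(** * Irreducible components in a topological space *)

Section Irreducibility.
Context (T : topologicalType).
Implicit Types X Z S : set T.

Lemma closure_sub_closed S F : closed F -> S `<=` F -> closure S `<=` F.
Proof. by rewrite closureE => Fcl SF; apply: smallest_sub. Qed.

Lemma irreducible_closure Z : irreducible_set Z -> irreducible_set (closure Z).
Proof.
move=> [[x Zx] Zirr]; split; first by exists x; apply: subset_closure.
move=> F1 F2 F1cl F2cl ZF.
case: (Zirr F1 F2 F1cl F2cl (subset_trans (@subset_closure _ Z) ZF)) => ZFi.
  by left; apply: closure_sub_closed.
by right; apply: closure_sub_closed.
Qed.

(** The closure of [Z] is again irreducible and stays inside the closed set [X],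
    so the maximality of [Z] forces it to be [Z]. *)
Lemma closed_irreducible_component X Z :
  closed X -> irreducible_component X Z -> closed Z.
Proof.
move=> Xcl [ZX Zirr Zmax]; apply/closure_id; apply/esym/Zmax.
- exact: irreducible_closure.
- exact: closure_sub_closed.
- exact: subset_closure.
Qed.

(** Irreducibility is applied to the cover of [Z] by the closure of [S] and the
    complement of [U], where [S] is cut out of [Z] by the open set [U]. *)
Lemma open_in_irreducible_dense Z S : irreducible_set Z -> open_in Z S ->
  S !=set0 -> Z `<=` closure S.
Proof.
move=> [_ Zirr] [U Uo SE] [x Sx].
have ZF : Z `<=` closure S `|` ~` U.
  move=> z Zz; have [Uz|] := pselect (U z); last by right.
  by left; apply: subset_closure; rewrite SE.
case: (Zirr _ _ (@closed_closure _ S) (open_closedC Uo) ZF) => // ZU.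
by move: Sx; rewrite SE => -[/ZU].
Qed.

Lemma open_in_meets_dense_in Z S D : open_in Z S -> dense_in Z D ->
  S !=set0 -> S `&` D !=set0.
Proof.
move=> [U Uo SE] [DZ Ddense] [x]; rewrite SE => -[Zx Ux].
have [y [Dy Uy]] := Ddense x Zx U (open_nbhs_nbhs (conj Uo Ux)).
by exists y; split=> //; split=> //; apply: DZ.
Qed.

End Irreducibility.

(** * Polynomial functions and the rank of polynomial matrices *)

Section PolynomialFunctions.
Context (K : fieldType) (V : vectType K).
Implicit Types f h : V -> K.

Definition polynomial_fun f := exists p, forall v, peval p v = f v.

Lemma polynomial_fun_cst c : polynomial_fun (fun=> c).
Proof. by exists c%:MP => v; rewrite /peval mevalC. Qed.

Lemma polynomial_funM f h : polynomial_fun f -> polynomial_fun h ->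
  polynomial_fun (fun v => f v * h v).
Proof.
by move=> [p pE] [q qE]; exists (p * q) => v; rewrite -pE -qE /peval mevalM.
Qed.

Lemma polynomial_fun_sum (I : Type) (s : seq I) (P : pred I)
    (F : I -> V -> K) : (forall i, polynomial_fun (F i)) ->
  polynomial_fun (fun v => \sum_(i <- s | P i) F i v).
Proof.
move=> /choice[p pE]; exists (\sum_(i <- s | P i) p i) => v.
by rewrite /peval raddf_sum; apply: eq_bigr => i _; apply: pE.
Qed.

Lemma polynomial_fun_prod (I : Type) (s : seq I) (P : pred I)
    (F : I -> V -> K) : (forall i, polynomial_fun (F i)) ->
  polynomial_fun (fun v => \prod_(i <- s | P i) F i v).
Proof.
move=> /choice[p pE]; exists (\prod_(i <- s | P i) p i) => v.
by rewrite /peval rmorph_prod; apply: eq_bigr => i _; apply: pE.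
Qed.

Lemma polynomial_fun_linear (f : {linear V -> K^o}) : polynomial_fun f.
Proof.
exists (\sum_(i < \dim {:V}) f (vbasis fullv)`_i *: 'X_i) => v.
rewrite /peval raddf_sum /= [in RHS](coord_vbasis (memvf v)) linear_sum /=.
by apply: eq_bigr => i _; rewrite mevalZ mevalXU linearZ /= mulrC.
Qed.

Definition polynomial_mx m n (M : V -> 'M[K]_(m, n)) :=
  forall i j, polynomial_fun (fun v => M v i j).

Lemma polynomial_mx_cst m n (A : 'M[K]_(m, n)) : polynomial_mx (fun=> A).
Proof. by move=> i j; apply: polynomial_fun_cst. Qed.

Lemma polynomial_mxM m n p (M : V -> 'M[K]_(m, n)) (N : V -> 'M[K]_(n, p)) :
  polynomial_mx M -> polynomial_mx N -> polynomial_mx (fun v => M v *m N v).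
Proof.
move=> Mpol Npol i j; under eq_fun do rewrite mxE.
by apply: polynomial_fun_sum => l; apply: polynomial_funM.
Qed.

Lemma polynomial_fun_tr n (M : V -> 'M[K]_n) :
  polynomial_mx M -> polynomial_fun (fun v => \tr (M v)).
Proof. by move=> Mpol; apply: polynomial_fun_sum => i; apply: Mpol. Qed.

Lemma polynomial_fun_det n (M : V -> 'M[K]_n) :
  polynomial_mx M -> polynomial_fun (fun v => \det (M v)).
Proof.
move=> Mpol; apply: polynomial_fun_sum => s; apply: polynomial_funM.
  exact: polynomial_fun_cst.
by apply: polynomial_fun_prod => i; apply: Mpol.
Qed.

End PolynomialFunctions.

(** Compressions $BAC$ to square matrices stand in for the minors of [A]: they
    are equally polynomial in [A], and a full rank one is at hand from a rank
    factorization. *)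
Lemma mxrank_ge_detP (K : fieldType) m n r (A : 'M[K]_(m, n)) :
  (r <= \rank A)%N <->
  exists (B : 'M[K]_(r, m)) (C : 'M[K]_(n, r)), \det (B *m A *m C) != 0.
Proof.
split=> [rA|[B [C]]]; last first.
  rewrite -unitfE -unitmxE => /mxrank_unit <-.
  by apply: leq_trans (mxrankM_maxl _ _) (mxrankM_maxr _ _).
have /row_fullP[B BE] := col_base_full A.
have /row_freeP[C CE] := row_base_free A.
have BAC : B *m A *m C = 1%:M.
  transitivity (B *m (col_base A *m row_base A) *m C).
    by rewrite mulmx_base.
  by rewrite mulmxA BE mul1mx CE.
exists (pid_mx r *m B), (C *m pid_mx r).
rewrite mulmxA -(mulmxA _ B) -(mulmxA _ (B *m A)) BAC mulmx1.
by rewrite pid_mx_id // pid_mx_1 det1 oner_eq0.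
Qed.

Lemma mxrank_ge_open (K : fieldType) (V : vectType K) m n
    (M : V -> 'M[K]_(m, n)) r : polynomial_mx M ->
  @open (affine V) [set v | (r <= \rank (M v))%N].
Proof.
move=> Mpol; rewrite zariski_openE.
exists [set p | exists (B : 'M[K]_(r, m)) (C : 'M[K]_(n, r)),
          forall v, peval p v = \det (B *m M v *m C)].
apply/seteqP; split=> v /= rkv.
  move=> p [B [C pE]]; rewrite pE; apply/eqP/negPn/negP => BC; apply: rkv.
  by apply/mxrank_ge_detP; exists B, C.
move=> /mxrank_ge_detP[B [C /eqP]]; apply.
have [p pE] : polynomial_fun (fun v => \det (B *m M v *m C)).
  apply: polynomial_fun_det; apply: polynomial_mxM; last first.
    exact: polynomial_mx_cst.
  by apply: polynomial_mxM => //; apply: polynomial_mx_cst.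
by rewrite -pE; apply: rkv; exists B, C.
Qed.

(** * The Gram form *)

Section GramForm.
Context (K : fieldType) (W : vectType K).
Notation product := 'Hom(W, 'End(W)).
Notation n := (\dim {:W}).
Notation e := (vbasis {:W}).
Implicit Types (mu : product) (g f h : 'End(W)) (v w : W).

Definition gram_mx mu : 'M[K]_n := \matrix_(i, j) gram_form mu e`_i e`_j.

Lemma lfun_traceC f h : lfun_trace (f \o h)%VF = lfun_trace (h \o f)%VF.
Proof.
by rewrite /lfun_trace !(mxof_comp _ _ (vbasisP {:W})) mxtrace_mulC.
Qed.

Lemma mulr_lfun_linear mu : linear (mulr_lfun mu).
Proof.
move=> a v w; apply/lfunP => x.
by rewrite add_lfunE scale_lfunE !mulr_lfunE linearP.
Qed.

Lemma mulr_lfun_linearl v : linear (fun mu => mulr_lfun mu v).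
Proof.
move=> a mu nu; apply/lfunP => x.
by rewrite /= !(add_lfunE, scale_lfunE, mulr_lfunE).
Qed.

Lemma gram_formC mu v w : gram_form mu v w = gram_form mu w v.
Proof. exact: lfun_traceC. Qed.

Lemma gram_form_linear mu v : linear (gram_form mu v : W -> K^o).
Proof.
move=> a w w'; rewrite /gram_form mulr_lfun_linear comp_lfunDr -comp_lfunZr.
by rewrite /lfun_trace !linearP.
Qed.
HB.instance Definition _ mu v :=
  GRing.isLinear.Build K W K^o _ (gram_form mu v) (gram_form_linear mu v).

Lemma gram_form_coord mu v w : gram_form mu v w =
  \sum_j (\sum_i coord e i v * gram_mx mu i j) * coord e j w.
Proof.
have coordr u x : gram_form mu u x =
    \sum_(j < n) coord e j x * gram_form mu u e`_j.
  rewrite {1}(coord_vbasis (memvf x)) (linear_sum (gram_form mu u)).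
  by apply: eq_bigr => j _; rewrite (linearZZ (gram_form mu u : {linear W -> K^o})).
rewrite coordr; apply: eq_bigr => j _; rewrite mulrC gram_formC coordr.
by congr (_ * _); apply: eq_bigr => i _; rewrite gram_formC mxE.
Qed.

(** The right multiplications of $g\mu$ are the conjugates
    $R^{g\mu}_v = g R^\mu_{g^{-1}v} g^{-1}$, and so are their products; the
    trace does not see the conjugation. *)
Lemma gram_form_transport g mu v w : g \in GL W ->
  gram_form (transport g mu) v w = gram_form mu (g^-1%VF v) (g^-1%VF w).
Proof.
move=> gGL; have mulr_transport u : mulr_lfun (transport g mu) u =
    (g \o (mulr_lfun mu (g^-1%VF u) \o g^-1))%VF.
  by apply/lfunP => x; rewrite !comp_lfunE !mulr_lfunE transportE.
have conj_comp f h : ((g \o (f \o g^-1)) \o (g \o (h \o g^-1)) =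
    g \o ((f \o h) \o g^-1))%VF.
  by apply/lfunP => x; rewrite !comp_lfunE (lker0_lfunK gGL).
rewrite /gram_form !mulr_transport conj_comp lfun_traceC -comp_lfunA.
by rewrite (lker0_compVf gGL) comp_lfun1r.
Qed.

(** A congruence by the matrix of $g^{-1}$, because $g\mu$ has on the fixed basis
    the Gram form that $\mu$ has on the basis moved by $g^{-1}$. *)
Lemma gram_mx_transport g mu : g \in GL W ->
  gram_mx (transport g mu) = mxof e e g^-1 *m gram_mx mu *m (mxof e e g^-1)^T.
Proof.
move=> gGL; apply/matrixP => i j.
have mxofE k l : mxof e e g^-1 k l = coord e l (g^-1%VF e`_k).
  by rewrite !mxE /= vecof_delta.
rewrite mxE gram_form_transport // gram_form_coord mxE.
apply: eq_bigr => l _; rewrite 2!mxE mxofE; congr (_ * _).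
by apply: eq_bigr => k _; rewrite mxofE.
Qed.

Lemma gram_rank_transport g mu : g \in GL W ->
  gram_rank (transport g mu) = gram_rank mu.
Proof.
move=> gGL; rewrite /gram_rank /form_rank -!/(gram_mx _) gram_mx_transport //.
have Pu : mxof e e g^-1 \in unitmx.
  have := congr1 (mxof e e) (lker0_compfV gGL).
  rewrite (mxof_comp _ _ (vbasisP {:W})) mxof1 ?(basis_free (vbasisP _)) //.
  by case/mulmx1_unit.
by rewrite mxrankMfree ?row_free_unit ?unitmx_tr // eqmxMfull ?row_full_unit.
Qed.

End GramForm.

Section GramRank.
Context (K : fieldType) (W : vectType K) (k : product_kind).
Notation A := (product_space W k).
Implicit Types (mu : A) (g : 'End(W)).

Lemma gram_rank_act g mu : g \in GL W ->
  gram_rank (vsval (act k g mu)) = gram_rank (vsval mu).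
Proof. by move=> gGL; rewrite actE gram_rank_transport. Qed.

Lemma GL_orbit_refl mu : GL_orbit mu mu.
Proof.
have idGL : (\1%VF : 'End(W)) \in GL W by rewrite inE; apply/lker0P => x y; rewrite !id_lfunE.
exists \1%VF => //; apply: val_inj; rewrite /= actE.
apply/lfunP => x; apply/lfunP => y.
have inv1 (u : W) : (\1^-1)%VF u = u.
  by have := lker0_lfunVK idGL u; rewrite id_lfunE.
by rewrite transportE id_lfunE !inv1.
Qed.

(** Each entry of the Gram matrix is the trace of a product of two matrices
    that depend linearly on the algebra. *)
Lemma polynomial_gram_mx : polynomial_mx (fun mu : A => gram_mx (vsval mu)).
Proof.
set e := vbasis {:W}.
have mulr_pol v : polynomial_mx (fun mu : A =>
    mxof e e (mulr_lfun (vsval mu) v)).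
  move=> i j; pose f (mu : A) : K^o := mxof e e (mulr_lfun (vsval mu) v) i j.
  have fL : linear f.
    by move=> a mu nu; rewrite /f linearP /= mulr_lfun_linearl linearP !mxE.
  pose fM := GRing.isLinear.Build _ _ _ _ f fL.
  exact: (polynomial_fun_linear (HB.pack f fM)).
move=> i j; under eq_fun do
  rewrite mxE /gram_form /lfun_trace (mxof_comp _ _ (vbasisP {:W})).
by apply/polynomial_fun_tr/polynomial_mxM.
Qed.

Lemma gram_rank_ge_open r :
  @open (affine A) [set mu | (r <= gram_rank (vsval mu))%N].
Proof. exact: mxrank_ge_open polynomial_gram_mx. Qed.

(** Two relatively open and dense loci meet, and at a common point the Gram rank
    takes both values. *)
Lemma generic_gram_rank_unique (Z : set (affine A)) r s : Z !=set0 ->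
  is_generic_gram_rank Z r -> is_generic_gram_rank Z s -> r = s.
Proof.
move=> [x Zx] [rO [_ rD]] [_ sD].
have [y [yr _]] := rD x Zx setT filterT.
have [z [[_ <-] [_ <-]]] := open_in_meets_dense_in rO sD (ex_intro _ y yr).
by [].
Qed.

Lemma generic_gram_rank_dense_orbit (Z : set (affine A)) mu :
  closure (GL_orbit mu) = Z -> is_generic_gram_rank Z (gram_rank (vsval mu)).
Proof.
move=> orbZ; set r := gram_rank _.
have orb_rank nu : GL_orbit mu nu -> gram_rank (vsval nu) = r.
  by move=> [g gGL <-]; apply: gram_rank_act.
have Z_le nu : Z nu -> (gram_rank (vsval nu) <= r)%N.
  rewrite -orbZ leqNgt => nu_cl; apply/negP => nu_gt.
  have [xi [/orb_rank xi_r]] :=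
    nu_cl _ (open_nbhs_nbhs (conj (gram_rank_ge_open r.+1) nu_gt)).
  by rewrite /= xi_r ltnn.
split.
  exists [set nu | (r <= gram_rank (vsval nu))%N].
    exact: gram_rank_ge_open.
  apply/seteqP; split=> nu [Znu] /=; first by move=> ->.
  by move=> le_r; split=> //; apply/eqP; rewrite eqn_leq Z_le.
split=> [nu []//|]; rewrite -{1}orbZ; apply: closure_subset => nu orb_nu.
by split; [rewrite -orbZ; apply: subset_closure | apply: orb_rank].
Qed.

End GramRank.

Theorem theorem4p6 (K : closedFieldType) (K0 : [pchar K] =i pred0)
    (W : vectType K) (k : product_kind)
    (Q : {pred {mpoly K[\dim {:product_space W k}]}})
    (Qsub : submod_closed Q) (Qquad : forall q, q \in Q -> q \is 2.-homog)
    (QG : GL_stable Q)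
    (Z : set (affine (product_space W k)))
    (Zcomp : irreducible_component (Var Q) Z)
    (mu : product_space W k) (muZ : Z mu) :
  (open_in Z (GL_orbit mu) -> closure (GL_orbit mu) = Z) /\
  (closure (GL_orbit mu) = Z ->
     gram_rank (vsval mu) = generic_gram_rank Z).
Proof.
have orb_mu : GL_orbit mu !=set0 by exists mu; apply: GL_orbit_refl.
split=> [orbO|orbZ].
  have Zcl : closed Z.
    apply: closed_irreducible_component Zcomp.
    by apply/zariski_closedP; eexists.
  case: Zcomp => _ Zirr _; apply/seteqP; split.
    by apply: closure_sub_closed => //; case: orbO => U _ -> nu [].
  exact: open_in_irreducible_dense.
have mu_gen := generic_gram_rank_dense_orbit orbZ.
apply/esym/xget_unique => // r r_gen.
by apply: generic_gram_rank_unique r_gen mu_gen; exists mu.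
Qed.
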